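(* Let $(\mathscr{W}_1,\delta)$ be a first-order codifferential calculus over a coalgebra $C$ and let $A=C^*$ be the dual algebra. Let $\mathscr{X}^1:=\mathrm{Hom}^C(C,\mathscr{W}_1)$ be the space of right $C$-colinear maps $C\to\mathscr{W}_1$, with left and right $A$-actions $$(a\triangleright X)(c)=a(c_{(1)})X(c_{(2)}),\qquad(X\triangleleft a)(c)=a(X(c)_{(-1)})X(c)_{(0)}$$ for $a\in A$, $X\in\mathscr{X}^1$, $c\in C$, and define $\mathscr{L}\colon\mathscr{X}^1\to\mathrm{End}_k(A)$ by $$\mathscr{L}_X(a)(c)=a(\delta(X(c))).$$ Then the pair $(\mathscr{X}^1,\mathscr{L})$ is a (right) Cartan pair over $A$.
   Context: $k$ is a field with $\mathrm{char}(k)\ne2$; everything is over $k$. In a $C$-bicomodule $W$ write $w_{(-1)}\otimes w_{(0)}$ and $w_{(0)}\otimes w_{(1)}$ for the left and right coactions. A first-order codifferential calculus over $C$ is a $C$-bicomodule $\mathscr{W}_1$ with a linear map $\delta\colon\mathscr{W}_1\to C$ such that $\Delta(\delta(w))=\delta(w_{(0)})\otimes w_{(1)}+w_{(-1)}\otimes\delta(w_{(0)})$ for all $w$ and such that $w\mapsto w_{(-1)}\otimes\delta(w_{(0)})\in C\otimes C$ is injective. The dual algebra $C^*$ has product $(ab)(c)=a(c_{(1)})b(c_{(2)})$ and unit $\varepsilon$. A right Cartan pair over a $k$-algebra $A$ is a pair $(\mathscr{X}^1,\mathscr{L})$ of an $A$-bimodule $\mathscr{X}^1$ and an injective linear map $\mathscr{L}\colon\mathscr{X}^1\to\mathrm{End}_k(A)$,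 $X\mapsto\mathscr{L}_X$, such that $\mathscr{L}_{aX}(b)=a\mathscr{L}_X(b)$ and $\mathscr{L}_X(ab)=\mathscr{L}_X(a)b+\mathscr{L}_{Xa}(b)$ for all $X\in\mathscr{X}^1$, $a,b\in A$. *)

(* Defs.v *)
From HB Require Import structures.
From mathcomp Require Import all_boot all_algebra.
From mathcomp Require Import boolp.

Set Implicit Arguments.
Unset Strict Implicit.
Unset Printing Implicit Defensive.

Import GRing.Theory.
Local Open Scope ring_scope.
Local Open Scope quotient_scope.

Declare Scope tensor_scope.
Delimit Scope tensor_scope with tensor.
Local Open Scope tensor_scope.

Reserved Notation "U ⊗ V" (at level 39, left associativity).
Reserved Notation "\sweedler_( u ⊗ v <- t ) F"
  (at level 34, F at level 41, u name, v name, t at level 50,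
   format "'[' \sweedler_( u  ⊗  v  <-  t ) '/  '  F ']'").

Notation bilinear f := (bilinear_for *:%R *:%R f).

(* The tensor product of two vector spaces: formal sums of pairs modulo the
   congruence generated by bilinearity. *)
Section TensorDef.
Variables (k : fieldType) (U V : lmodType k).

Inductive tensor_eqv : seq (U * V) -> seq (U * V) -> Prop :=
| TeqvRefl s : tensor_eqv s s
| TeqvSym s t : tensor_eqv s t -> tensor_eqv t s
| TeqvTrans s t r : tensor_eqv s t -> tensor_eqv t r -> tensor_eqv s r
| TeqvCat s s' t t' :
    tensor_eqv s s' -> tensor_eqv t t' -> tensor_eqv (s ++ t) (s' ++ t')
| TeqvCatC s t : tensor_eqv (s ++ t) (t ++ s)
| Teqv0l v : tensor_eqv [:: (0, v)] [::]
| Teqv0r u : tensor_eqv [:: (u, 0)] [::]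
| TeqvDl u u' v : tensor_eqv [:: (u + u', v)] [:: (u, v); (u', v)]
| TeqvDr u v v' : tensor_eqv [:: (u, v + v')] [:: (u, v); (u, v')]
| TeqvZ a u v : tensor_eqv [:: (a *: u, v)] [:: (u, a *: v)].

Definition tensor_eqvb (s t : seq (U * V)) : bool := `[< tensor_eqv s t >].

Lemma tensor_eqvb_refl : reflexive tensor_eqvb.
Proof. by move=> s; apply/asboolP; apply: TeqvRefl. Qed.

Lemma tensor_eqvb_sym : symmetric tensor_eqvb.
Proof. by move=> s t; apply/asboolP/asboolP; apply: TeqvSym. Qed.

Lemma tensor_eqvb_trans : transitive tensor_eqvb.
Proof.
by move=> t s r /asboolP st /asboolP tr; apply/asboolP; apply: TeqvTrans tr.
Qed.

Canonical tensor_equiv :=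
  EquivRel tensor_eqvb tensor_eqvb_refl tensor_eqvb_sym tensor_eqvb_trans.

Definition tensor : Type := {eq_quot tensor_equiv}.
HB.instance Definition _ := Choice.on tensor.
HB.instance Definition _ := EqQuotient.on tensor.

Implicit Types (x y z : tensor) (s t : seq (U * V)).

Let cls s : tensor := \pi_tensor s.

Lemma tensor_piP s t : \pi_tensor s = \pi_tensor t <-> tensor_eqv s t.
Proof.
split=> [/eqmodP|st]; first by move/asboolP.
by apply/eqmodP; apply/asboolP.
Qed.

Lemma tensor_eqv_repr s : tensor_eqv (repr (cls s)) s.
Proof. by apply/tensor_piP; rewrite reprK. Qed.

Definition scalep (a : k) (p : U * V) : U * V := (a *: p.1, p.2).

Lemma tensor_eqv_scale a s t : tensor_eqv s t ->
  tensor_eqv [seq scalep a p | p <- s] [seq scalep a p | p <- t].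
Proof.
elim=> {s t} [s|s t _ IH|s t r _ IH1 _ IH2|s s' t t' _ IH1 _ IH2|s t|v|u|u u' v
             |u v v'|b u v] /=.
- exact: TeqvRefl.
- exact: TeqvSym.
- exact: TeqvTrans IH2.
- by rewrite !map_cat; apply: TeqvCat.
- by rewrite !map_cat; apply: TeqvCatC.
- by rewrite /scalep /= scaler0; apply: Teqv0l.
- exact: Teqv0r.
- by rewrite /scalep /= scalerDr; apply: TeqvDl.
- exact: TeqvDr.
- by rewrite /scalep /= !scalerA mulrC -scalerA; apply: TeqvZ.
Qed.

Definition tadd x y : tensor := cls (repr x ++ repr y).
Definition tscale a x : tensor := cls [seq scalep a p | p <- repr x].
Definition topp x : tensor := tscale (-1) x.

Lemma tadd_pi s t : tadd (cls s) (cls t) = cls (s ++ t).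
Proof. by apply/tensor_piP; apply: TeqvCat; apply: tensor_eqv_repr. Qed.

Lemma tscale_pi a s : tscale a (cls s) = cls [seq scalep a p | p <- s].
Proof. by apply/tensor_piP/tensor_eqv_scale/tensor_eqv_repr. Qed.

Lemma tensor_clsP x : exists s, x = cls s.
Proof. by exists (repr x); rewrite /cls reprK. Qed.

Lemma taddA : associative tadd.
Proof.
move=> x y z; have [s ->] := tensor_clsP x; have [t ->] := tensor_clsP y.
by have [r ->] := tensor_clsP z; rewrite !tadd_pi catA.
Qed.

Lemma taddC : commutative tadd.
Proof. by move=> x y; apply/tensor_piP/TeqvCatC. Qed.

Lemma tadd0 : left_id (cls [::]) tadd.
Proof. by move=> x; have [s ->] := tensor_clsP x; rewrite tadd_pi. Qed.

Lemma tscaleDl x : {morph tscale^~ x : a b / a + b >-> tadd a b}.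
Proof.
move=> a b; have [s ->] := tensor_clsP x; rewrite !tscale_pi tadd_pi.
apply/tensor_piP; elim: s => [|p s IH] /=; first exact: TeqvRefl.
set sa := map (scalep a) s in IH *; set sb := map (scalep b) s in IH *.
have eqp : tensor_eqv [:: scalep (a + b) p] ([:: scalep a p] ++ [:: scalep b p]).
  by rewrite /scalep scalerDl; apply: TeqvDl.
apply: (TeqvTrans (TeqvCat eqp IH)); rewrite -catA.
rewrite -[_ :: _ ++ _]cat1s; apply: TeqvCat; first exact: TeqvRefl.
rewrite -[_ :: sb]cat1s !catA; apply: TeqvCat; last exact: TeqvRefl.
exact: TeqvCatC.
Qed.

Lemma tscale0 x : tscale 0 x = cls [::].
Proof.
have [s ->] := tensor_clsP x; rewrite tscale_pi; apply/tensor_piP.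
elim: s => [|p s IH] /=; first exact: TeqvRefl.
rewrite -cat1s -[[::]]/([::] ++ [::]); apply: TeqvCat => //.
by rewrite /scalep scale0r; apply: Teqv0l.
Qed.

Lemma tscale1 : left_id 1 tscale.
Proof.
move=> x; have [s ->] := tensor_clsP x; rewrite tscale_pi; congr (cls _).
by rewrite -[RHS]map_id; apply: eq_map => -[u v]; rewrite /scalep /= scale1r.
Qed.

Lemma taddN : left_inverse (cls [::]) topp tadd.
Proof.
by move=> x; rewrite -[X in tadd _ X]tscale1 -tscaleDl addNr tscale0.
Qed.

HB.instance Definition _ := GRing.isZmodule.Build tensor taddA taddC tadd0 taddN.

Lemma tscaleA a b x : tscale a (tscale b x) = tscale (a * b) x.
Proof.
have [s ->] := tensor_clsP x; rewrite !tscale_pi -map_comp; congr (cls _).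
by apply: eq_map => -[u v]; rewrite /scalep /= scalerA.
Qed.

Lemma tscaleDr : right_distributive tscale +%R.
Proof.
move=> a x y; have [s ->] := tensor_clsP x; have [t ->] := tensor_clsP y.
by rewrite [cls s + cls t]tadd_pi !tscale_pi map_cat; exact/esym/tadd_pi.
Qed.

HB.instance Definition _ :=
  GRing.Zmodule_isLmodule.Build k tensor tscaleA tscale1 tscaleDr tscaleDl.

Definition tens (u : U) (v : V) : tensor := cls [:: (u, v)].

Lemma tens_bilinear : bilinear tens.
Proof.
split=> [v a u u'|u a v v'].
  rewrite /tens /= [a *: cls _]tscale_pi [RHS]tadd_pi; exact/tensor_piP/TeqvDl.
rewrite /tens /= [a *: cls _]tscale_pi [RHS]tadd_pi; apply/tensor_piP.
apply: (TeqvTrans (TeqvDr _ _ _)).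
rewrite -cat1s; apply: TeqvCat; last exact: TeqvRefl.
exact/TeqvSym/TeqvZ.
Qed.

HB.instance Definition _ :=
  bilinear_isBilinear.Build k U V tensor *:%R *:%R tens tens_bilinear.

Lemma tensor_pi_sum s : \pi_tensor s = \sum_(p <- s) tens p.1 p.2.
Proof.
elim: s => [|[u v] s IH]; first by rewrite big_nil.
by rewrite big_cons -IH [RHS]tadd_pi.
Qed.

Lemma tensor_reprE x : x = \sum_(p <- repr x) tens p.1 p.2.
Proof. by rewrite -tensor_pi_sum reprK. Qed.

(* [tsum (\sum_i u_i ⊗ v_i) f] is [\sum_i f u_i v_i]; it is computed on a
   representative, hence meaningful only for a bilinear f (see [tsum_tens]). *)
Definition tsum (W : lmodType k) (x : tensor) (f : U -> V -> W) : W :=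
  \sum_(p <- repr x) f p.1 p.2.

Lemma bilinear_eqv (W : lmodType k) (f : {bilinear U -> V -> W}) s t :
  tensor_eqv s t -> \sum_(p <- s) f p.1 p.2 = \sum_(p <- t) f p.1 p.2.
Proof.
elim=> {s t} [s|s t _ IH|s t r _ IH1 _ IH2|s s' t t' _ IH1 _ IH2|s t|v|u|u u' v
             |u v v'|b u v] /=.
- by [].
- by [].
- by rewrite IH1.
- by rewrite !big_cat /= IH1 IH2.
- by rewrite !big_cat /= addrC.
- by rewrite big_seq1 big_nil /= linear0l.
- by rewrite big_seq1 big_nil /= linear0r.
- by rewrite big_seq1 big_cons big_seq1 /= linearDl.
- by rewrite big_seq1 big_cons big_seq1 /= linearDr.
- by rewrite !big_seq1 /= linearZl_LR linearZr_LR.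
Qed.

Section Lift.
Variables (W : lmodType k) (f : U -> V -> W).
Hypothesis f_bil : bilinear f.

Let F : {bilinear U -> V -> W} := HB.pack f
  (bilinear_isBilinear.Build k U V W *:%R *:%R f f_bil).

Lemma tsum_pi s : tsum (\pi_tensor s) f = \sum_(p <- s) f p.1 p.2.
Proof. exact: (bilinear_eqv F (tensor_eqv_repr s)). Qed.

Lemma tsum_tens u v : tsum (tens u v) f = f u v.
Proof. by rewrite tsum_pi big_seq1. Qed.

Lemma tsum_linear : linear (fun x : tensor => tsum x f).
Proof.
move=> a x y; have [s ->] := tensor_clsP x; have [t ->] := tensor_clsP y.
rewrite [a *: cls _]tscale_pi [cls _ + cls _]tadd_pi !tsum_pi big_cat big_map /=.
rewrite scaler_sumr; congr (_ + _); apply: eq_bigr => -[u v] _ /=.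
exact: (linearZl_LR F v a u).
Qed.

End Lift.

Lemma tensor_lin_ext (W : lmodType k) (f g : tensor -> W) :
  linear f -> linear g -> (forall u v, f (tens u v) = g (tens u v)) -> f =1 g.
Proof.
move=> fl gl fg x; have [s ->] := tensor_clsP x.
have lin0 (h : tensor -> W) : linear h -> h 0 = 0.
  by move=> hl; have := zmod_morphism_linear hl 0 0; rewrite !subrr.
rewrite /cls tensor_pi_sum; elim: s => [|p s IH].
  by rewrite big_nil !lin0.
rewrite big_cons -[tens _ _]scale1r fl gl IH.
by rewrite !scale1r fg.
Qed.

End TensorDef.

Arguments tens {k U V}.
Arguments tsum {k U V W}.

Notation "U ⊗ V" := (tensor U%type V%type) : type_scope.
Notation "u ⊗ v" := (tens u v) : tensor_scope.

Notation "\sweedler_( u ⊗ v <- t ) F" := (tsum t (fun u v => F)) : tensor_scope.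

Section TensorMaps.
Variable k : fieldType.

Definition tmap (U U' V V' : lmodType k) (f : U -> U') (g : V -> V')
    (x : U ⊗ V) : U' ⊗ V' :=
  \sweedler_(u ⊗ v <- x) f u ⊗ g v.

Definition tassoc (U V W : lmodType k) (x : U ⊗ V ⊗ W) : U ⊗ (V ⊗ W) :=
  \sweedler_(t ⊗ w <- x) \sweedler_(u ⊗ v <- t) u ⊗ (v ⊗ w).

End TensorMaps.

Section TensorMapsTheory.
Variable k : fieldType.

Lemma bilinearP (U V W : lmodType k) (f : U -> V -> W) :
  (forall v, linear (f^~ v)) -> (forall u, linear (f u)) -> bilinear f.
Proof. by split. Qed.

Lemma tmap_bilinear (U U' V V' : lmodType k) (f : {linear U -> U'})
  (g : {linear V -> V'}) : bilinear (fun u v => f u ⊗ g v).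
Proof.
apply: bilinearP => [v|u] a x y /=; rewrite linearP.
  by rewrite linearDl linearZl_LR.
by rewrite linearDr linearZr_LR.
Qed.

Lemma tmap_tens (U U' V V' : lmodType k) (f : {linear U -> U'})
  (g : {linear V -> V'}) u v : tmap f g (u ⊗ v) = f u ⊗ g v.
Proof. exact/tsum_tens/tmap_bilinear. Qed.

Lemma tmap_linear (U U' V V' : lmodType k) (f : {linear U -> U'})
  (g : {linear V -> V'}) : linear (tmap f g).
Proof. exact/tsum_linear/tmap_bilinear. Qed.

Lemma tassoc_bilinear_in (U V W : lmodType k) (w : W) :
  bilinear (fun (u : U) (v : V) => u ⊗ (v ⊗ w)).
Proof.
apply: bilinearP => [v|u] a x y.
  by rewrite linearDl linearZl_LR.
by rewrite linearDl linearDr linearZl_LR linearZr_LR.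
Qed.

Lemma tassoc_bilinear (U V W : lmodType k) :
  bilinear (fun (t : U ⊗ V) (w : W) => \sweedler_(u ⊗ v <- t) u ⊗ (v ⊗ w)).
Proof.
apply: bilinearP => [w|t]; first exact/tsum_linear/tassoc_bilinear_in.
move=> a w w'; rewrite /tsum scaler_sumr -big_split /=.
by apply: eq_bigr => p _; rewrite !(linearDr, linearZr_LR).
Qed.

Lemma tassoc_tens (U V W : lmodType k) (u : U) (v : V) (w : W) :
  tassoc (u ⊗ v ⊗ w) = u ⊗ (v ⊗ w).
Proof.
rewrite /tassoc (tsum_tens (@tassoc_bilinear U V W)).
by rewrite (tsum_tens (@tassoc_bilinear_in U V W w)).
Qed.

Lemma tassoc_linear (U V W : lmodType k) : linear (@tassoc k U V W).
Proof. exact/tsum_linear/tassoc_bilinear. Qed.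

End TensorMapsTheory.

Section LinearSpace.
Variables (k : fieldType) (U V : lmodType k).

Lemma linear_funext (f g : {linear U -> V}) : f =1 g -> f = g.
Proof.
case: f g => [f [[fa] [fs]]] [g [[ga] [gs]]] /= /funext fg.
by case: _ / fg in ga gs *; congr GRing.Linear.Pack; congr GRing.Linear.Class;
  [congr Algebra.isNmodMorphism.Axioms_|congr GRing.isScalable.Axioms_];
  apply: Prop_irrelevance.
Qed.

HB.instance Definition _ := gen_eqMixin {linear U -> V}.
HB.instance Definition _ := gen_choiceMixin {linear U -> V}.

Implicit Types f g h : {linear U -> V}.

Lemma lin_scale_linear a f : linear (fun u => a *: f u).
Proof. by move=> b x y; rewrite linearP scalerDr !scalerA mulrC. Qed.

Definition lin_scale a f : {linear U -> V} := HB.pack (fun u => a *: f u)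
  (GRing.isLinear.Build k U V *:%R (fun u => a *: f u) (lin_scale_linear a f)).

Definition lin_zero : {linear U -> V} := \0.
Definition lin_opp f : {linear U -> V} := \- f.
Definition lin_add f g : {linear U -> V} := f \+ g.

Fact lin_addA : associative lin_add.
Proof. by move=> f g h; apply: linear_funext => u; apply: addrA. Qed.
Fact lin_addC : commutative lin_add.
Proof. by move=> f g; apply: linear_funext => u; apply: addrC. Qed.
Fact lin_add0 : left_id lin_zero lin_add.
Proof. by move=> f; apply: linear_funext => u; apply: add0r. Qed.
Fact lin_addN : left_inverse lin_zero lin_opp lin_add.
Proof. by move=> f; apply: linear_funext => u; apply: addNr. Qed.

HB.instance Definition _ := GRing.isZmodule.Build {linear U -> V}
  lin_addA lin_addC lin_add0 lin_addN.

Fact lin_scaleA a b f : lin_scale a (lin_scale b f) = lin_scale (a * b) f.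
Proof. by apply: linear_funext => u; apply: scalerA. Qed.
Fact lin_scale1 : left_id 1 lin_scale.
Proof. by move=> f; apply: linear_funext => u; apply: scale1r. Qed.
Fact lin_scaleDr : right_distributive lin_scale +%R.
Proof. by move=> a f g; apply: linear_funext => u; apply: scalerDr. Qed.
Fact lin_scaleDl f : {morph lin_scale^~ f : a b / a + b}.
Proof. by move=> a b; apply: linear_funext => u; apply: scalerDl. Qed.

HB.instance Definition _ := GRing.Zmodule_isLmodule.Build k {linear U -> V}
  lin_scaleA lin_scale1 lin_scaleDr lin_scaleDl.

Lemma lin_addE f g u : (f + g) u = f u + g u. Proof. by []. Qed.
Lemma lin_scaleE a f u : (a *: f) u = a *: f u. Proof. by []. Qed.

End LinearSpace.

HB.mixin Record isCoalgebra (k : fieldType) C of GRing.Lmodule k C := {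
  comul : {linear C -> (C ⊗ C)%type};
  counit : {linear C -> k^o};
  comulA : forall c,
    tassoc (tmap comul id (comul c)) = tmap id comul (comul c);
  counitl : forall c, \sweedler_(c1 ⊗ c2 <- comul c) (counit c1 *: c2) = c;
  counitr : forall c, \sweedler_(c1 ⊗ c2 <- comul c) (counit c2 *: c1) = c }.

#[short(type="coalgType")]
HB.structure Definition Coalgebra (k : fieldType) :=
  {C of isCoalgebra k C & GRing.Lmodule k C}.

HB.mixin Record isLeftComodule (k : fieldType) (C : coalgType k) W
    of GRing.Lmodule k W := {
  lcoact : {linear W -> (C ⊗ W)%type};
  lcoactA : forall w,
    tassoc (tmap comul id (lcoact w)) = tmap id lcoact (lcoact w);
  lcounit : forall w, \sweedler_(c ⊗ w' <- lcoact w) (counit c *: w') = w }.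

#[short(type="leftComodType")]
HB.structure Definition LeftComodule (k : fieldType) (C : coalgType k) :=
  {W of isLeftComodule k C W & GRing.Lmodule k W}.

HB.mixin Record isRightComodule (k : fieldType) (C : coalgType k) W
    of GRing.Lmodule k W := {
  rcoact : {linear W -> (W ⊗ C)%type};
  rcoactA : forall w,
    tassoc (tmap rcoact id (rcoact w)) = tmap id comul (rcoact w);
  rcounit : forall w, \sweedler_(w' ⊗ c <- rcoact w) (counit c *: w') = w }.

#[short(type="rightComodType")]
HB.structure Definition RightComodule (k : fieldType) (C : coalgType k) :=
  {W of isRightComodule k C W & GRing.Lmodule k W}.

HB.mixin Record LeftRight_isBicomodule (k : fieldType) (C : coalgType k) W
    of LeftComodule k C W & RightComodule k C W := {
  lrcoactA : forall w : W,
    tassoc (tmap lcoact id (rcoact w)) = tmap id rcoact (lcoact w) }.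

#[short(type="bicomodType")]
HB.structure Definition Bicomodule (k : fieldType) (C : coalgType k) :=
  {W of LeftRight_isBicomodule k C W & LeftComodule k C W
      & RightComodule k C W}.

Section RegularComodule.
Variables (k : fieldType) (C : coalgType k).

HB.instance Definition _ := isRightComodule.Build k C C
  (@comulA k C) (@counitr k C).

End RegularComodule.

Section Colinear.
Variables (k : fieldType) (C : coalgType k) (M N : rightComodType C).

Definition colinear (f : M -> N) : Prop :=
  forall m, rcoact (f m) = tmap f id (rcoact m).

Definition colinear_pred : {pred {linear M -> N}} :=
  fun f => `[< colinear f >].

Fact colinear_submod : submod_closed colinear_pred.
Proof.
split=> [|a f g /asboolP fC /asboolP gC]; apply/asboolP=> m.
  rewrite raddf0 /tmap /tsum big1 // => p _.
  by rewrite linear0l.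
rewrite linearP fC gC /tmap /tsum scaler_sumr -big_split /=.
by apply: eq_bigr => p _; rewrite linearDl linearZl_LR.
Qed.

HB.instance Definition _ := GRing.isSubmodClosed.Build k {linear M -> N}
  colinear_pred colinear_submod.

Record colin_hom := ColinHom {
  colin_fun :> {linear M -> N};
  _ : colin_fun \in colinear_pred }.

HB.instance Definition _ := [isSub for colin_fun].
HB.instance Definition _ := [Choice of colin_hom by <:].
HB.instance Definition _ := [SubChoice_isSubLmodule of colin_hom by <:].

Lemma colin_homP (f : colin_hom) : colinear f.
Proof. by case: f => f fP; apply/asboolP. Qed.

End Colinear.

(* Unital associative k-algebras. The library's [algType k] is not used because
   it excludes the zero ring, which is the dual algebra of the zero coalgebra. *)
HB.mixin Record isAssocAlgebra (k : fieldType) A of GRing.Lmodule k A := {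
  amul : A -> A -> A;
  aone : A;
  amul_bilinear : bilinear amul;
  amulA : associative amul;
  amul1l : left_id aone amul;
  amul1r : right_id aone amul }.

#[short(type="assocAlgType")]
HB.structure Definition AssocAlgebra (k : fieldType) :=
  {A of isAssocAlgebra k A & GRing.Lmodule k A}.

Notation "a ∙ b" := (amul a b) (at level 40, left associativity) : tensor_scope.

Section Dual.
Variables (k : fieldType) (C : coalgType k).

Definition dual : Type := {linear C -> k^o}.
HB.instance Definition _ := GRing.Lmodule.on dual.

Definition dual_fun (a : dual) : C -> k := (a : {linear C -> k^o}).
Coercion dual_fun : dual >-> Funclass.

Implicit Types a b : dual.

Lemma dual_mul_bilinear a b : bilinear (fun c1 c2 : C => a c1 * b c2 : k^o).
Proof.
apply: bilinearP => [v|u] x c d; rewrite /dual_fun linearP.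
  by rewrite mulrDl; congr (_ + _); apply/esym/mulrA.
by rewrite mulrDr; congr (_ + _); apply: mulrCA.
Qed.

Fact dual_mul_linear a b :
  linear (fun c => \sweedler_(c1 ⊗ c2 <- comul c) (a c1 * b c2 : k^o)).
Proof. by move=> x c d; rewrite linearP tsum_linear //; apply: dual_mul_bilinear. Qed.

Definition dual_mul a b : dual := HB.pack
  (fun c => \sweedler_(c1 ⊗ c2 <- comul c) (a c1 * b c2 : k^o))
  (GRing.isLinear.Build k C k^o *:%R _ (dual_mul_linear a b)).

Definition dual_one : dual := counit.

Fact dual_mul_is_bilinear : bilinear dual_mul.
Proof.
apply: bilinearP => [b|a] x a1 a2; apply: linear_funext => c /=.
  rewrite /tsum scaler_sumr -big_split /=; apply: eq_bigr => p _.
  by rewrite /dual_fun /= mulrDl; congr (_ + _); apply/esym/mulrA.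
rewrite /tsum scaler_sumr -big_split /=; apply: eq_bigr => p _.
by rewrite /dual_fun /= mulrDr; congr (_ + _); apply: mulrCA.
Qed.

Fact dual_mul1l : left_id dual_one dual_mul.
Proof.
move=> a; apply: linear_funext => c /=.
rewrite -[in RHS](counitl c) /tsum linear_sum; apply: eq_bigr => p _.
by rewrite linearZ.
Qed.

Fact dual_mul1r : right_id dual_one dual_mul.
Proof.
move=> a; apply: linear_funext => c /=.
rewrite -[in RHS](counitr c) /tsum linear_sum; apply: eq_bigr => p _.
by rewrite linearZ mulrC.
Qed.

Fact dual_mulA : associative dual_mul.
Proof.
move=> a1 a2 a3; apply: linear_funext => c.
pose G (t : C ⊗ (C ⊗ C)) : k^o :=
  \sweedler_(x ⊗ s <- t) (a1 x * \sweedler_(y ⊗ z <- s) (a2 y * a3 z : k^o) : k^o).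
have inL x : linear (fun s : C ⊗ C =>
    (a1 x * \sweedler_(y ⊗ z <- s) (a2 y * a3 z : k^o)) : k^o).
  move=> d s s'; rewrite (tsum_linear (dual_mul_bilinear a2 a3)).
  by rewrite mulrDr; congr (_ + _); apply: mulrCA.
have Gb : bilinear (fun (x : C) (s : C ⊗ C) =>
    (a1 x * \sweedler_(y ⊗ z <- s) (a2 y * a3 z : k^o)) : k^o).
  apply: bilinearP => // s d x y; rewrite {1}/dual_fun linearP.
  by rewrite mulrDl; congr (_ + _); apply/esym/mulrA.
have Gl := tsum_linear Gb.
transitivity (G (tmap id comul (comul c))).
  apply: (tensor_lin_ext (f := fun t => \sweedler_(x ⊗ y <- t)
       (a1 x * dual_mul a2 a3 y : k^o)) (g := fun t => G (tmap id comul t))).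
  - exact/tsum_linear/dual_mul_bilinear.
  - by move=> d s t; rewrite (tmap_linear idfun comul); apply: Gl.
  move=> x y; rewrite (tmap_tens idfun comul) /G (tsum_tens Gb).
  by rewrite (tsum_tens (dual_mul_bilinear _ _)).
rewrite -comulA; apply/esym.
have aL := @tassoc_linear k C C C.
apply: (tensor_lin_ext (f := fun t => \sweedler_(x ⊗ y <- t)
       (dual_mul a1 a2 x * a3 y : k^o))
       (g := fun t => G (tassoc (tmap comul id t)))).
- exact/tsum_linear/dual_mul_bilinear.
- by move=> d s t; rewrite (tmap_linear comul idfun) aL; apply: Gl.
move=> x z; rewrite (tmap_tens comul idfun) (tsum_tens (dual_mul_bilinear _ _)).
apply: (tensor_lin_ext (f := fun t => (\sweedler_(u ⊗ v <- t)
       (a1 u * a2 v : k^o)) * a3 z : k^o) (g := fun t => G (tassoc (t ⊗ z)))).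
- move=> d s t; rewrite (tsum_linear (dual_mul_bilinear a1 a2)).
  by rewrite mulrDl; congr (_ + _); apply/esym/mulrA.
- by move=> d s t; rewrite linearDl linearZl_LR aL; apply: Gl.
move=> u v; rewrite tassoc_tens /G (tsum_tens Gb).
by rewrite !(tsum_tens (dual_mul_bilinear _ _)) mulrA.
Qed.

HB.instance Definition _ := isAssocAlgebra.Build k dual
  dual_mul_is_bilinear dual_mulA dual_mul1l dual_mul1r.

End Dual.

Definition first_order_codifferential_calculus (k : fieldType) (C : coalgType k)
    (W : bicomodType C) (delta : {linear W -> C}) : Prop :=
  (forall w, comul (delta w) =
     tmap delta id (rcoact w) + tmap id delta (lcoact w)) /\
  injective (fun w => tmap id delta (lcoact w) : C ⊗ C).

Record is_bimodule (k : fieldType) (A : assocAlgType k) (X : lmodType k)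
    (lact : A -> X -> X) (ract : X -> A -> X) : Prop := IsBimodule {
  lact_bilinear : bilinear lact;
  ract_bilinear : bilinear ract;
  lact1 : forall x, lact aone x = x;
  lactM : forall a b x, lact (a ∙ b) x = lact a (lact b x);
  ract1 : forall x, ract x aone = x;
  ractM : forall x a b, ract x (a ∙ b) = ract (ract x a) b;
  lractA : forall a x b, ract (lact a x) b = lact a (ract x b) }.

Record right_cartan_pair (k : fieldType) (A : assocAlgType k) (X : lmodType k)
    (lact : A -> X -> X) (ract : X -> A -> X)
    (L : {linear X -> {linear A -> A}}) : Prop := RightCartanPair {
  cartan_bimodule : is_bimodule lact ract;
  cartan_inj : injective L;
  cartan_lact : forall a x b, L (lact a x) b = a ∙ L x b;
  cartan_leibniz : forall x a b, L x (a ∙ b) = L x a ∙ b + L (ract x a) b }.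

(* Main.v *)
From HB Require Import structures.
From mathcomp Require Import all_boot all_algebra.
From mathcomp Require Import boolp classical_sets.
Require Import Defs.

Set Implicit Arguments.
Unset Strict Implicit.
Unset Printing Implicit Defensive.

Import GRing.Theory.
Local Open Scope ring_scope.
Local Open Scope tensor_scope.

(** Both actions come from one family of maps.  For a left comodule [M] and
    [a] in the dual algebra let [ltrans a] be the endomorphism
    [m |-> a(m_(-1)) m_(0)] of [M].  Coassociativity and counitality of the
    coaction say exactly that [a |-> ltrans a] is a right module structure over
    the dual algebra ([ltransM], [ltrans1]), and when [M] is a bicomodule the
    compatibility of its two coactions says that [ltrans a] is right colinear
    ([ltrans_colinear]).  The coalgebra [C] is a bicomodule over itself, and for
    [X : C -> W] colinear one has

      [a |> X = X o ltrans a]    and    [X <| a = ltrans a o X],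

    so that the bimodule axioms reduce to associativity of composition.  The
    product of the dual algebra is of the same kind, [a b = b o ltrans a]
    ([dual_mulE]), which makes left linearity of [L] immediate.

    For the Leibniz rule, evaluate [ab] at [delta(X(c))], that is, apply [a] to
    the first leg of [Delta(delta(X(c)))] and [b] to the second.  The
    codifferential identity splits this into two terms: in
    [delta(w_(0)) ⊗ w_(1)], with [w = X(c)], colinearity of [X] turns the
    summand into [L_X(a)] times [b]; in [w_(-1) ⊗ delta(w_(0))] contraction
    with [a] replaces [X] by [X <| a].

    For injectivity of [L], if [L_X = 0] then [delta o X = 0], since linear
    forms separate the points of [C] ([dual_separates], by Zorn's lemma).  Then
    [Delta(delta(X(c)))] vanishes, and so does
    [delta(X(c)_(0)) ⊗ X(c)_(1) = delta(X(c_(1))) ⊗ c_(2)] by colinearity.  What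
    remains of the codifferential identity is
    [X(c)_(-1) ⊗ delta(X(c)_(0)) = 0], and [X(c) = 0] by the injectivity axiom
    of the calculus ([colin_eq0]). *)

(** * Linear forms separate points *)

(** A subspace [H] maximal among those avoiding [v] is a complement of the line
    spanned by [v]: if [u] is not in [H], then [v] lies in [H + k u], so [u]
    lies in [H + k v].  The form is the coordinate along [v] relative to [H]. *)
Lemma dual_separates (k : fieldType) (V : lmodType k) (v : V) :
  v != 0 -> exists a : {linear V -> k^o}, a v != 0.
Proof.
move=> v_neq0.
(* [H 0] is left out, so that the union of the empty chain qualifies.  A
   nonempty [H] contains 0, and a maximal one is nonempty: the empty set is
   strictly inside {0}, which avoids [v]. *)
pose avoids (H : set V) := (forall x y z, H y -> H z -> H (x *: y + z)) /\ ~ H v.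
have [H [Hlin Hv] Hmax] :
    exists2 H, avoids H & forall B, (H `<` B)%classic -> ~ avoids B.
  have [|H [Ha Hm]] := @Zorn_bigcup V avoids; last by exists H.
  move=> F Fav Ftot; split=> [x y z [A FA Ay] [B FB Bz]|[A FA Av]].
    have [AB|BA] := Ftot A B FA FB.
      by exists B => //; apply: (Fav B FB).1 => //; apply: AB.
    by exists A => //; apply: (Fav A FA).1 => //; apply: BA.
  exact: (Fav A FA).2.
have H0 : H 0.
  apply: contrapT => nH0; apply: (Hmax (fun u => u = 0)).
    split=> [u Hu|]; last by move=> /(_ 0 erefl).
    by case: nH0; rewrite -(addNr u) -scaleN1r; apply: Hlin.
  split=> [x y z -> ->|v0]; first by rewrite scaler0 addr0.
  by rewrite v0 eqxx in v_neq0.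
have HZ x y : H y -> H (x *: y) by move=> Hy; rewrite -[_ *: _]addr0; apply: Hlin.
have coefP u : exists x : k, H (u - x *: v).
  have [Hu|nHu] := pselect (H u); first by exists 0; rewrite scale0r subr0.
  pose B : set V := fun t => exists x, H (t - x *: u).
  have HB : (H `<` B)%classic.
    split=> [t Ht|BH]; first by exists 0; rewrite scale0r subr0.
    by apply/nHu/BH; exists 1; rewrite scale1r subrr.
  have [x Hx] : B v.
    apply: contrapT => nBv; apply: (Hmax B HB); split=> // x y z [b Hy] [c Hz].
    exists (x * b + c); rewrite scalerDl -scalerA opprD addrACA -scalerBr.
    exact: Hlin.
  have x_neq0 : x != 0.
    by apply: contra_notN Hv => /eqP x0; rewrite x0 scale0r subr0 in Hx.
  exists x^-1; move: (HZ (- x^-1) _ Hx).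
  by rewrite scalerBr !scaleNr opprK scalerA mulVf // scale1r addrC.
have [f fP] := choice coefP.
have f_uniq u x : H (u - x *: v) -> f u = x.
  move=> Hx; apply/eqP; rewrite -subr_eq0; apply/negPn/negP => d_neq0.
  apply: Hv; rewrite -[v]scale1r -(mulVf d_neq0) -scalerA; apply: HZ.
  have -> : (f u - x) *: v = -1 *: (u - f u *: v) + (u - x *: v).
    by rewrite scaleN1r opprB scalerBl addrA subrK.
  exact: Hlin.
have f_lin : linear (f : V -> k^o).
  move=> x y z; apply: f_uniq.
  rewrite scalerDl opprD addrACA -scalerA -scalerBr; exact: Hlin.
pose a : {linear V -> k^o} :=
  HB.pack (f : V -> k^o) (GRing.isLinear.Build k V k^o *:%R _ f_lin).
exists a => /=.
by rewrite (f_uniq v 1) ?oner_neq0 // scale1r subrr.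
Qed.

(** * Contraction of a tensor with a linear form *)

Section Contraction.
Variable k : fieldType.

HB.instance Definition _ (U U' V V' : lmodType k) (f : {linear U -> U'})
    (g : {linear V -> V'}) :=
  GRing.isLinear.Build k (U ⊗ V)%type (U' ⊗ V')%type *:%R (tmap f g)
    (tmap_linear f g).

HB.instance Definition _ (U V W : lmodType k) :=
  GRing.isLinear.Build k (U ⊗ V ⊗ W)%type (U ⊗ (V ⊗ W))%type *:%R
    (@tassoc k U V W) (@tassoc_linear k U V W).

Lemma eq_tensor_linear (U V W : lmodType k)
    (f g : {linear (U ⊗ V)%type -> W}) :
  (forall u v, f (u ⊗ v) = g (u ⊗ v)) -> f =1 g.
Proof. exact/tensor_lin_ext/linearP/linearP. Qed.

Lemma tmap_compl (U U' U'' V : lmodType k) (g : {linear U' -> U''})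
    (f : {linear U -> U'}) (t : U ⊗ V) :
  tmap (g \o f) id t = tmap g id (tmap f id t).
Proof.
apply: (eq_tensor_linear (f := tmap (g \o f) idfun)
          (g := tmap g idfun \o tmap f idfun)) => u v /=.
by rewrite !tmap_tens.
Qed.

Definition tcontract (U V : lmodType k) (a : U -> k) (t : U ⊗ V) : V :=
  \sweedler_(u ⊗ v <- t) (a u *: v).

Lemma tcontract_bilinear (U V : lmodType k) (a : {linear U -> k^o}) :
  bilinear (fun (u : U) (v : V) => (a u : k) *: v).
Proof.
apply: bilinearP => [v|u] x y z; first by rewrite linearP scalerDl -scalerA.
by rewrite scalerDr !scalerA mulrC.
Qed.

Lemma tcontract_linear (U V : lmodType k) (a : {linear U -> k^o}) :
  linear (@tcontract U V a).
Proof. exact/tsum_linear/tcontract_bilinear. Qed.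

HB.instance Definition _ (U V : lmodType k) (a : {linear U -> k^o}) :=
  GRing.isLinear.Build k (U ⊗ V)%type V *:%R (@tcontract U V a)
    (tcontract_linear a).

Lemma tcontract_tens (U V : lmodType k) (a : {linear U -> k^o}) (u : U) (v : V) :
  tcontract a (u ⊗ v) = (a u : k) *: v.
Proof. exact/tsum_tens/tcontract_bilinear. Qed.

Lemma tcontract_tmap (U V V' : lmodType k) (a : {linear U -> k^o})
    (f : {linear V -> V'}) t :
  tcontract a (tmap id f t) = f (tcontract a t).
Proof.
apply: (eq_tensor_linear (f := @tcontract U V' a \o tmap idfun f)
          (g := f \o @tcontract U V a)) => u v /=.
by rewrite tmap_tens !tcontract_tens linearZ.
Qed.

Lemma tcontract_tassoc (U V W : lmodType k) (a : {linear U -> k^o}) t :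
  tcontract a (@tassoc k U V W t) = tmap (@tcontract U V a) id t.
Proof.
apply: (eq_tensor_linear (f := @tcontract _ _ a \o @tassoc k U V W)
          (g := tmap (@tcontract U V a) idfun)) => s w /=.
apply: (eq_tensor_linear
          (f := @tcontract _ _ a \o @tassoc k U V W \o applyr tens w)
          (g := tmap (@tcontract U V a) idfun \o applyr tens w)) => u v /=.
by rewrite tassoc_tens tmap_tens /= !tcontract_tens linearZl_LR.
Qed.

End Contraction.

(** * Translation of a comodule by a linear form *)

(** The regular bicomodule: coassociativity of the coproduct is at once the
    left comodule axiom and the compatibility of the two coactions.  It lets
    the left action on [Hom^C(C, W)] be treated as a translation of [C]. *)
Section RegularBicomodule.
Variables (k : fieldType) (C : coalgType k).

HB.instance Definition _ := isLeftComodule.Build k C C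
  (@comulA k C) (@counitl k C).

HB.instance Definition _ := LeftRight_isBicomodule.Build k C C (@comulA k C).

End RegularBicomodule.

Section Translation.
Variables (k : fieldType) (C : coalgType k).
Implicit Types a b : dual C.

Definition ltrans (M : leftComodType C) a (m : M) : M :=
  tcontract a (lcoact m).

Lemma ltrans_linear (M : leftComodType C) a : linear (@ltrans M a).
Proof. by move=> x m n; rewrite /ltrans !linearP. Qed.

HB.instance Definition _ (M : leftComodType C) a :=
  GRing.isLinear.Build k M M *:%R (@ltrans M a) (@ltrans_linear M a).

Lemma ltransP (M : leftComodType C) x a b (m : M) :
  ltrans (x *: a + b) m = x *: ltrans a m + ltrans b m.
Proof.
rewrite /ltrans /tcontract /tsum scaler_sumr -big_split /=.
by apply: eq_bigr => p _; rewrite scalerDl scalerA.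
Qed.

Lemma ltrans1 (M : leftComodType C) (m : M) : ltrans (aone : dual C) m = m.
Proof. exact: lcounit. Qed.

Lemma dual_mulE a b c : (a ∙ b) c = b (ltrans a c).
Proof.
rewrite /ltrans /tcontract /tsum /dual_fun linear_sum.
by apply: eq_bigr => p _; rewrite linearZ.
Qed.

(** The comodule axiom contracted with [a] in the first leg and [b] in the
    second; hence the reversal of the factors. *)
Lemma ltransM (M : leftComodType C) a b (m : M) :
  ltrans (a ∙ b) m = ltrans b (ltrans a m).
Proof.
rewrite {2 3}/ltrans -tcontract_tmap -lcoactA tcontract_tassoc -tmap_compl.
rewrite /ltrans.
apply: (eq_tensor_linear (f := @tcontract _ C M (a ∙ b))
  (g := @tcontract _ C M b \o tmap (@tcontract _ C C a \o comul) idfun)).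
move=> c n; rewrite [RHS]/= tmap_tens [LHS](tcontract_tens (a ∙ b : dual C)).
by rewrite [RHS]tcontract_tens (dual_mulE a b).
Qed.

(** Contraction with [a] consumes the left leg only, so it commutes with the
    right coaction once the two coactions are compatible. *)
Lemma ltrans_colinear (M : bicomodType C) a :
  colinear (@ltrans M a : {linear M -> M}).
Proof.
move=> m; rewrite /ltrans /= -tcontract_tmap -lrcoactA.
by rewrite tcontract_tassoc -tmap_compl.
Qed.

Lemma colinear_comp (M N P : rightComodType C) (g : {linear N -> P})
    (f : {linear M -> N}) : colinear g -> colinear f -> colinear (g \o f).
Proof. by move=> gC fC m /=; rewrite gC fC -tmap_compl. Qed.

End Translation.

(** * The Cartan pair of a codifferential calculus *)

Section Cartan.
Variables (k : fieldType) (C : coalgType k) (W : bicomodType C).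
Variable delta : {linear W -> C}.
Implicit Types (a b : dual C) (X Y : colin_hom C W).

Lemma colin_hom_ext X Y : X =1 Y -> X = Y.
Proof. by move=> XY; apply/val_inj/linear_funext. Qed.

Lemma colin_homPE x X Y c : (x *: X + Y) c = x *: X c + Y c.
Proof. by []. Qed.

Definition colin_lact a X : colin_hom C W :=
  ColinHom (asboolT (colinear_comp (colin_homP X) (@ltrans_colinear k C C a))).

Definition colin_ract X a : colin_hom C W :=
  ColinHom (asboolT (colinear_comp (@ltrans_colinear k C W a) (colin_homP X))).

Lemma colin_lactE a X c : colin_lact a X c = X (ltrans a c).
Proof. by []. Qed.

Lemma colin_ractE X a c : colin_ract X a c = ltrans a (X c).
Proof. by []. Qed.

Lemma colin_bimodule : is_bimodule colin_lact colin_ract.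
Proof.
split.
- apply: bilinearP => [X x a b|a x X Y]; apply: colin_hom_ext => c.
    by rewrite colin_homPE !colin_lactE ltransP linearP.
  by rewrite colin_homPE !colin_lactE.
- apply: bilinearP => [a x X Y|X x a b]; apply: colin_hom_ext => c.
    by rewrite colin_homPE !colin_ractE colin_homPE linearP.
  by rewrite colin_homPE !colin_ractE ltransP.
- by move=> X; apply: colin_hom_ext => c; rewrite colin_lactE ltrans1.
- by move=> a b X; apply: colin_hom_ext => c; rewrite !colin_lactE ltransM.
- by move=> X; apply: colin_hom_ext => c; rewrite colin_ractE ltrans1.
- by move=> X a b; apply: colin_hom_ext => c; rewrite !colin_ractE ltransM.
- by move=> a X b; apply: colin_hom_ext.
Qed.

Definition lie_op X a : dual C :=
  ((a : {linear C -> k^o}) \o (delta \o X) : {linear C -> k^o}).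

Lemma lie_op_linear X : linear (lie_op X).
Proof. by move=> x a b; apply: linear_funext. Qed.

Definition lie X : {linear dual C -> dual C} :=
  HB.pack (lie_op X)
    (GRing.isLinear.Build k (dual C) (dual C) *:%R _ (lie_op_linear X)).

Lemma lie_linear : linear lie.
Proof.
move=> x X Y; apply: linear_funext => a; apply: linear_funext => c.
have -> : lie (x *: X + Y) a c = a (delta (x *: X c + Y c)) by [].
by rewrite [delta _]linearP; apply: linearP.
Qed.

HB.instance Definition _ :=
  GRing.isLinear.Build k (colin_hom C W) {linear dual C -> dual C} *:%R
    lie lie_linear.

Hypothesis W_calculus : first_order_codifferential_calculus delta.

(** When [delta o X] vanishes, colinearity of [X] kills the summand
    [delta(w_(0)) ⊗ w_(1)] of the codifferential identity at [w = X(c)], and the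
    other summand determines [w]. *)
Lemma colin_eq0 X : (forall c, delta (X c) = 0) -> X = 0.
Proof.
move=> dX0; have [leib inj] := W_calculus.
have dlX0 c : tmap id delta (lcoact (X c)) = 0.
  have := leib (X c); rewrite dX0 linear0 colin_homP -tmap_compl.
  rewrite [X in X + _](_ : _ = 0) ?add0r => [/esym //|].
  by rewrite /tmap /tsum big1 // => p _ /=; rewrite dX0 linear0l.
apply: colin_hom_ext => c; apply: inj.
rewrite [LHS]dlX0 [lcoact _]linear0.
by apply/esym/(linear0 (tmap idfun delta)).
Qed.

(** If [L_X] and [L_Y] agree, then no linear form tells [delta(X(c))] from
    [delta(Y(c))], so [delta] vanishes on the values of [X - Y]. *)
Lemma lie_inj : injective lie.
Proof.
move=> X Y eqXY; apply/eqP; rewrite -subr_eq0; apply/eqP/colin_eq0 => c.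
rewrite [delta _](linearB delta); apply/eqP/negPn/negP => /dual_separates [a].
have aXY : a (delta (X c)) = a (delta (Y c)).
  exact: (congr1 (fun l : {linear dual C -> dual C} => l a c) eqXY).
by rewrite linearB aXY subrr eqxx.
Qed.

Lemma lie_leibniz X a b : lie X (a ∙ b) = lie X a ∙ b + lie (colin_ract X a) b.
Proof.
apply: linear_funext => c.
have [leib _] := W_calculus.
rewrite lin_addE.
have -> : lie (colin_ract X a) b c = b (delta (ltrans a (X c))) by [].
have -> : lie X (a ∙ b) c = b (tcontract a (comul (delta (X c)))).
  exact: (dual_mulE a b (delta (X c))).
rewrite leib [tcontract _ _]linearD [LHS]linearD.
(* the second summand contracts to [delta (ltrans a (X c))] *)
rewrite [GRing.Linear.sort _ (tmap id _ _)]tcontract_tmap.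
rewrite colin_homP -tmap_compl; congr (_ + _).
rewrite [RHS](dual_mulE (lie X a) b c) /ltrans; congr (b _).
(* both sides are [a(delta(X(c_(1)))) c_(2)] *)
apply: (eq_tensor_linear (f := @tcontract _ C C a \o tmap (delta \o X) idfun)
  (g := @tcontract _ C C (lie X a))) => u v /=.
by rewrite tmap_tens !tcontract_tens.
Qed.

Lemma lie_lact a X b : lie (colin_lact a X) b = a ∙ lie X b.
Proof. by apply: linear_funext => c; rewrite [RHS](dual_mulE a (lie X b) c). Qed.

End Cartan.

Theorem proposition6p12 (k : fieldType) (k_char : 2%N \notin [pchar k])
    (C : coalgType k) (W : bicomodType C) (delta : {linear W -> C})
    (W_calculus : first_order_codifferential_calculus delta) :
  exists (lact : dual C -> colin_hom C W -> colin_hom C W)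
         (ract : colin_hom C W -> dual C -> colin_hom C W)
         (L : {linear colin_hom C W -> {linear dual C -> dual C}}),
    [/\ forall (a : dual C) (X : colin_hom C W) (c : C),
          lact a X c = \sweedler_(c1 ⊗ c2 <- comul c) (a c1 *: X c2),
        forall (X : colin_hom C W) (a : dual C) (c : C),
          ract X a c = \sweedler_(c' ⊗ w <- lcoact (X c)) (a c' *: w),
        forall (X : colin_hom C W) (a : dual C) (c : C),
          L X a c = a (delta (X c))
      & right_cartan_pair lact ract L].
Proof.
exists (@colin_lact k C W), (@colin_ract k C W), (lie delta); split=> //.
  move=> a X c; rewrite colin_lactE /ltrans /tcontract /tsum linear_sum.
  by apply: eq_bigr => p _; rewrite linearZ.
split.
- exact: colin_bimodule.
- exact: lie_inj.
- by move=> a X b; apply: lie_lact.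
- by move=> X a b; apply: lie_leibniz.
Qed.
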